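(* Let $n\ge 1$ and let $A\in\mathcal{M}_n(\mathbb{C})$. Then: 1. $W_c(A)=\{\tau_n(AB): B=(b_{ij})\in\mathcal{M}_n(\mathbb{C}),\ B\geq 0,\ b_{ii}=1 \text{ for } 1\le i\le n\}$. 2. $W_c(A)\subseteq W(A)$. 3. $W_c(A)$ is convex. 4. $\tau_n(A)\in W_c(A)$. 5. If $D\in\mathcal{D}_n$, then $W_c(A+D)=W_c(A)+\tau_n(D)$. 6. For $\lambda\in\mathbb{C}$, $W_c(A)=\{\lambda\}$ if and only if $A$ is diagonal and $\tau_n(A)=\lambda$. 7. $W_c(A)\subseteq\mathbb{R}$ if and only if $\operatorname{Im}A$ is diagonal and $\tau_n(\operatorname{Im}A)=0$. 8. If $\{A_k\}_{k\ge 1}$ is a sequence in $\mathcal{M}_n(\mathbb{C})$ with $\|A_k-A\|\to 0$, then $$W_c(A)=\left\{\lim_{k\to\infty}\lambda_k : \lambda_k\in W_c(A_k)\text{ for } k\ge 1 \text{ and } \lim_{k\to\infty}\lambda_k \text{ exists}\right\}.$$ 9. $W_c(A^T)=W_c(A)$, where $A^T$ is the transpose of $A$.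
   Context: $\mathcal{M}_n(\mathbb{C})$ is the algebra of $n\times n$ complex matrices, $\mathcal{D}_n$ is the set of diagonal $n\times n$ matrices, $\tau_n=\frac1n\mathrm{Tr}$ is the normalized trace, $\|\cdot\|$ is the operator norm, $B\ge 0$ means positive semidefinite, and $\operatorname{Im}A=\frac{1}{2i}(A-A^* )$. The numerical range of an operator $T$ on a Hilbert space $\mathcal{H}$ is $W(T)=\{\langle Tx,x\rangle : x\in\mathcal{H},\ \|x\|=1\}$. The correlation numerical range $W_c(A)$ of $A=(\alpha_{ij})\in\mathcal{M}_n(\mathbb{C})$ is defined as follows. Let $\hat A=(\alpha_{ij}I_n)$ be the $n\times n$ block matrix acting on $H=\mathbb{C}^n\oplus\cdots\oplus\mathbb{C}^n$ ($n$ copies), and let $E$ be the set of vectors $\frac{1}{\sqrt n}(e_1,e_2,\dots,e_n)^T\in H$ with $e_1,\dots,e_n\in\mathbb{C}^n$ and $\|e_1\|=\cdots=\|e_n\|=1$. Then $W_c(A)=\{\langle\hat A e,e\rangle: e\in E\}$. *)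

(* Defs.v *)
From HB Require Import structures.
From mathcomp Require Import all_boot all_order all_algebra.
From mathcomp Require Import complex.
From mathcomp Require Import all_classical all_reals all_analysis.

Set Implicit Arguments.
Unset Strict Implicit.
Unset Printing Implicit Defensive.

Import Order.TTheory GRing.Theory Num.Theory.
Import numFieldNormedType.Exports.

Local Open Scope classical_set_scope.
Local Open Scope ring_scope.
Local Open Scope sesquilinear_scope.
Local Open Scope complex_scope.

(** [dotmx] is defined on row vectors; operators act here on column vectors.
    The product is linear in [x] and conjugate-linear in [y]. *)
Definition inner (R : realType) (m : nat) (x y : 'cV[R[i]]_m) : R[i] :=
  dotmx x^T y^T.

Definition norm2 (R : realType) (m : nat) (x : 'cV[R[i]]_m) : R :=
  Num.sqrt (complex.Re (inner x x)).

Definition opnorm (R : realType) (m : nat) (T : 'M[R[i]]_m) : R :=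
  sup [set norm2 (T *m x) | x in [set x : 'cV[R[i]]_m | norm2 x = 1]].

(** The order of [R[i]] makes [0 <= z] mean that [z] is real and nonnegative;
    over the complex numbers this forces [B] to be Hermitian. *)
Definition psdmx (R : realType) (m : nat) (B : 'M[R[i]]_m) : Prop :=
  forall x : 'cV[R[i]]_m, 0 <= inner (B *m x) x.

Definition ntrace (R : realType) (n : nat) (A : 'M[R[i]]_n) : R[i] :=
  n%:R^-1 * \tr A.

(** ['i] is the imaginary unit of [R[i]], and [^t*] the conjugate transpose. *)
Definition Im_mx (R : realType) (n : nat) (A : 'M[R[i]]_n) : 'M[R[i]]_n :=
  (2 * 'i%R)^-1 *: (A - A ^t*).

Definition num_range (R : realType) (m : nat) (T : 'M[R[i]]_m) : set R[i] :=
  [set inner (T *m x) x | x in [set x : 'cV[R[i]]_m | norm2 x = 1]].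

(** The direct sum of [n] copies of [C^n] is the space of column vectors of
    size [\sum_(i < n) n], with [\mxcol] stacking the components. *)
Definition hat_mx (R : realType) (n : nat) (A : 'M[R[i]]_n) :
    'M[R[i]]_(\sum_(i < n) n) :=
  \mxblock_(i < n, j < n) ((A i j)%:M : 'M[R[i]]_n).

Definition corr_vectors (R : realType) (n : nat) :
    set 'cV[R[i]]_(\sum_(i < n) n) :=
  [set (sqrtC n%:R)^-1 *: \mxcol_(i < n) e i
     | e in [set e : 'I_n -> 'cV[R[i]]_n | forall i, norm2 (e i) = 1]].

Definition corr_num_range (R : realType) (n : nat) (A : 'M[R[i]]_n) :
    set R[i] :=
  [set inner (hat_mx A *m e) e | e in @corr_vectors R n].

(* Main.v *)
(** Stacking unit vectors e_1, ..., e_n as the rows of E, with adjoint E', the value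
    attached to them is tau_n(A E E'), and the Gram matrices E E' are exactly the
    positive semidefinite matrices with unit diagonal. Convexity, translation by diagonal
    matrices and transposition are read off this description.

    If x_c are the columns of E then Tr(A E E') is the sum of the <A x_c, x_c>, so
    the inclusion in W(A) is the Toeplitz-Hausdorff theorem, in the homogeneous
    form: for all x, y some z has <Tz, z> = <Tx, x> + <Ty, y> and
    |z|^2 = |x|^2 + |y|^2. Writing z = a x + b y, with u = (a, b)^T, these are three
    real linear conditions on the 2x2 Hermitian matrix u u^* - 1, which leave at least a
    line; the line through 1 in that direction meets the boundary of the positive
    semidefinite cone in a matrix of rank at most one, which gives (a, b).

    For the singleton criterion, B = 1 + th E_ji + th^* E_ij with th = 1 and th = i
    isolates the off-diagonal entries of A. It yields the reality criterion, as
    W_c(Im A) is the set of imaginary parts of W_c(A). The limit statement follows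
    from the boundedness of the Gram matrices and the closedness of W_c(A), which
    comes from the compactness of the set of matrices E with unit rows. *)

Require Import Defs.
From HB Require Import structures.
From mathcomp Require Import all_boot all_order all_algebra.
From mathcomp Require Import complex.
From mathcomp Require Import all_classical all_reals all_analysis.
From mathcomp Require Import ring lra.

Set Implicit Arguments.
Unset Strict Implicit.
Unset Printing Implicit Defensive.

Import Order.TTheory GRing.Theory Num.Theory.
Import numFieldNormedType.Exports.

Local Open Scope classical_set_scope.
Local Open Scope ring_scope.
Local Open Scope sesquilinear_scope.

(** * The inner product on column vectors *)

Section Inner.
Context {R : realType}.
Local Notation C := (complex R).

Lemma innerE m (x y : 'cV[C]_m) : inner x y = \sum_k x k 0 * (y k 0)^*.
Proof.
by rewrite /inner dotmxE mxE; apply: eq_bigr => k _; rewrite !mxE.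
Qed.

Lemma inner_ge0 m (x : 'cV[C]_m) : 0 <= inner x x.
Proof. by rewrite innerE sumr_ge0// => k _; exact: mul_conjC_ge0. Qed.

Lemma innerDl m (x y z : 'cV[C]_m) : inner (x + y) z = inner x z + inner y z.
Proof.
by rewrite !innerE -big_split; apply: eq_bigr => k _; rewrite mxE mulrDl.
Qed.

Lemma innerZl m a (x y : 'cV[C]_m) : inner (a *: x) y = a * inner x y.
Proof.
by rewrite !innerE mulr_sumr; apply: eq_bigr => k _; rewrite mxE mulrA.
Qed.

Lemma innerDr m (x y z : 'cV[C]_m) : inner z (x + y) = inner z x + inner z y.
Proof.
by rewrite !innerE -big_split; apply: eq_bigr => k _; rewrite mxE rmorphD mulrDr.
Qed.

Lemma innerZr m a (x y : 'cV[C]_m) : inner x (a *: y) = a^* * inner x y.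
Proof.
by rewrite !innerE mulr_sumr; apply: eq_bigr => k _; rewrite mxE rmorphM mulrCA.
Qed.

Lemma inner_conj m (x y : 'cV[C]_m) : inner y x = (inner x y)^*.
Proof.
rewrite !innerE rmorph_sum; apply: eq_bigr => k _.
by rewrite rmorphM/= conjCK mulrC.
Qed.

Lemma inner_mxcol n p (x y : 'I_n -> 'cV[C]_p) :
  inner (\mxcol_(i < n) x i) (\mxcol_(i < n) y i) = \sum_i inner (x i) (y i).
Proof.
have -> : inner (\mxcol_(i < n) x i) (\mxcol_(i < n) y i) =
    ((\mxcol_(i < n) x i)^T *m (\mxcol_(i < n) (y i ^ Num.conj))) 0 0.
  rewrite /inner dotmxE trmxK; congr ((_ *m _) 0 0).
  by apply/matrixP => i j; rewrite !mxE.
rewrite tr_mxcol mul_mxrow_mxcol summxE.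
by apply: eq_bigr => i _; rewrite /inner dotmxE trmxK.
Qed.

Lemma norm2_eq1 m (x : 'cV[C]_m) : norm2 x = 1 <-> inner x x = 1.
Proof.
have := inner_ge0 x; rewrite /norm2 lecE => /= /andP[/eqP Im0 Re0].
split=> [/(congr1 (fun u => u ^+ 2))|->]; last by rewrite sqrtr1.
by rewrite sqr_sqrtr// expr1n; case: (inner x x) Im0 => a b /= -> ->.
Qed.

Lemma normC_norm2 m (x : 'cV[C]_m) : ((norm2 x)%:C)%C ^+ 2 = inner x x.
Proof.
have := inner_ge0 x; rewrite /norm2 lecE => /= /andP[/eqP Im0 Re0].
by rewrite -rmorphXn/= sqr_sqrtr//; case: (inner x x) Im0 => a b /= ->.
Qed.

End Inner.

(** * Values of the range as traces against Gram matrices *)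

Section CorrelationRange.
Context {R : realType}.
Local Notation C := (complex R).

Lemma gram_diag n (E : 'M[C]_n) i :
  (E *m E^t*) i i = inner (row i E)^T (row i E)^T.
Proof. by rewrite mxE innerE; apply: eq_bigr => k _; rewrite !mxE. Qed.

Lemma psdmx_gram m p (E : 'M[C]_(m, p)) : psdmx (E *m E^t*).
Proof.
move=> x; suff -> : inner (E *m E^t* *m x) x = inner (E^t* *m x) (E^t* *m x).
  exact: inner_ge0.
rewrite /inner !dotmxE !trmx_mul !map_mxM !trmxK; congr (_ 0 0).
by rewrite -!mulmxA map_trmx trmxK -map_mx_comp (map_mx_id (@conjCK _)).
Qed.

Lemma ntraceE n (A B : 'M[C]_n) :
  ntrace (A *m B) = n%:R^-1 * \sum_i \sum_j A i j * B j i.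
Proof. by rewrite /ntrace; congr (_ * _); apply: eq_bigr => i _; rewrite mxE. Qed.

(** The block form at unit vectors [e i] is the sum of [A i j * inner (e j) (e i)] divided by [n],
    and [inner (e j) (e i)] is the [(j, i)] entry of the Gram matrix of the rows [e i]. *)
Lemma corr_num_rangeE n (A : 'M[C]_n) :
  corr_num_range A =
  [set ntrace (A *m (E *m E^t*)) | E in
     [set E : 'M[C]_n | forall i, (E *m E^t*) i i = 1]].
Proof.
have key (E : 'M[C]_n) (v := (sqrtC n%:R)^-1 *: \mxcol_i (row i E)^T) :
    inner (hat_mx A *m v) v = ntrace (A *m (E *m E^t*)).
  rewrite /v -scalemxAr innerZl innerZr mulrA -normCK normfV.
  rewrite ger0_norm ?sqrtC_ge0 ?ler0n// exprVn sqrtCK.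
  rewrite /hat_mx mul_mxblock_mxrow inner_mxcol ntraceE.
  congr (_ * _); apply: eq_bigr => i _.
  transitivity (\sum_j inner (A i j *: (row j E)^T) (row i E)^T).
    rewrite innerE.
    under eq_bigr => k _ do rewrite summxE mulr_suml.
    rewrite exchange_big; apply: eq_bigr => j _ /=; rewrite innerE.
    by apply: eq_bigr => k _; rewrite mul_scalar_mx.
  apply: eq_bigr => j _; rewrite innerZl; congr (_ * _).
  by rewrite innerE mxE; apply: eq_bigr => k _; rewrite !mxE.
apply/seteqP; split=> z.
  move=> [_ [e e1 <-] <-].
  exists (\matrix_(i, j) e i j 0) => [i|].
    rewrite gram_diag.
    have -> : (row i (\matrix_(i, j) e i j 0))^T = e i.
      by apply/colP => k; rewrite !mxE.
    exact/norm2_eq1.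
  rewrite -key (_ : \mxcol_i _ = \mxcol_i e i)//; apply/eq_mxcol => i.
  by apply/colP => k; rewrite !mxE.
move=> [E E1 <-]; rewrite -key; eexists; last by [].
exists (fun i => (row i E)^T) => // i.
by apply/norm2_eq1; rewrite -gram_diag.
Qed.

End CorrelationRange.

Local Opaque inner.

(** * Positive semidefinite matrices are Gram matrices *)

Section PositiveSemidefinite.
Context {R : realType}.
Local Notation C := (complex R).

Lemma inner_mulmx m (x y : 'cV[C]_m) : inner x y = (y^t* *m x) 0 0.
Proof.
by rewrite innerE mxE; apply: eq_bigr => k _; rewrite !mxE mulrC.
Qed.

(** Here [u], [v], [a], [b] stand for [<Bx, x>], [<By, y>], [<Bx, y>], [<By, x>]. Reality of the
    form at [x + i y] and at [x + y] makes [i (b - a)] and [a + b] real. *)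
Lemma conj_polarization (u v a b : C) : u^* = u -> v^* = v ->
  (u + - 'i * a + ('i * b + 'i * (- 'i * v)))^* =
    u + - 'i * a + ('i * b + 'i * (- 'i * v)) ->
  (u + a + (b + v))^* = u + a + (b + v) -> a^* = b.
Proof.
move=> ur vr; rewrite !rmorphD !rmorphM/= !rmorphN/= conjCi ur vr => e1 e2.
have e3 : a^* + b^* = a + b.
  have -> : a^* + b^* = (u + a^* + (b^* + v)) - u - v by ring.
  by rewrite e2; ring.
have e4 : 'i * (a^* - b^*) = 'i * (b - a).
  have -> : 'i * (a^* - b^*) =
    (u + - - 'i * a^* + (- 'i * b^* + - 'i * (- - 'i * v))) - u + 'i ^+ 2 * v.
    by ring.
  by rewrite e1; ring.
have e5 : a^* - b^* = b - a by apply: (mulfI (neq0Ci _)).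
apply: (@mulfI _ 2); first by rewrite pnatr_eq0.
have -> : 2 * a^* = (a^* + b^*) + (a^* - b^*) by ring.
by rewrite e3 e5; ring.
Qed.

Lemma psdmx_hermitian m (B : 'M[C]_m) : psdmx B -> B^t* = B.
Proof.
move=> B_ge0.
have realf z : (inner (B *m z) z)^* = inner (B *m z) z.
  by apply/CrealP; exact: ger0_real.
suff herm x y : (inner (B *m x) y)^* = inner (B *m y) x.
  have entry i j : B i j = inner (B *m delta_mx j 0) (delta_mx i 0).
    rewrite -colE innerE (bigD1 i)//= big1 => [|k ki].
      by rewrite !mxE !eqxx conjC1 mulr1 addr0.
    by rewrite !mxE (negPf ki) conjC0 mulr0.
  by apply/matrixP => i j; rewrite !mxE [in LHS]entry herm -entry.
have := realf (x + y); have := realf (x + 'i *: y).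
rewrite !mulmxDr -!scalemxAr !innerDl !innerDr !innerZl !innerZr conjCi.
move: (realf x) (realf y).
move: (inner _ x) (inner _ y) (inner (B *m x) y) (inner (B *m y) x).
exact: conj_polarization.
Qed.

(** The spectral theorem gives [B = P^t* diag(d) P]; each [d_k] is the quadratic form at column [k]
    of [P^t*], hence nonnegative, and [E = P^t* diag(sqrt d)] works. *)
Lemma psdmx_factor m (B : 'M[C]_m) : psdmx B -> exists E : 'M[C]_m, B = E *m E^t*.
Proof.
move=> B_ge0; have Bherm : B \is hermsymmx.
  by apply/is_hermitianmxP; rewrite expr0 scale1r psdmx_hermitian.
have /orthomx_spectralP := hermitian_normalmx Bherm.
have Pu := spectral_unitarymx B.
set P := spectralmx B in Pu *; set d := spectral_diag B.
rewrite (invmx_unitary Pu) => BE.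
have PP : P *m P^t* = 1%:M by apply/unitarymxP.
have d_ge0 k : 0 <= d 0 k.
  have := B_ge0 (P^t* *m delta_mx k 0).
  rewrite inner_mulmx {1}BE trmx_mul map_mxM map_trmx trmxK -map_mx_comp.
  rewrite (map_mx_id (@conjCK _)) -!mulmxA (mulmxA P (P^t*)) PP mul1mx.
  rewrite (mulmxA P (P^t*)) PP mul1mx.
  rewrite trmx_delta map_delta_mx -rowE -colE.
  by rewrite !mxE eqxx mulr1n.
pose s := map_mx sqrtC d.
have sE : (diag_mx s)^t* = diag_mx s.
  rewrite tr_diag_mx map_diag_mx; congr diag_mx; apply/rowP => k; rewrite !mxE.
  by apply/CrealP/ger0_real; rewrite sqrtC_ge0.
exists (P^t* *m diag_mx s).
rewrite trmx_mul map_mxM sE map_trmx trmxK -map_mx_comp (map_mx_id (@conjCK _)).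
rewrite -mulmxA (mulmxA (diag_mx s)) mulmx_diag mulmxA BE.
congr (_ *m diag_mx _ *m _).
by apply/rowP => k; rewrite !mxE -expr2 sqrtCK.
Qed.

Lemma corr_num_range_psd n (A : 'M[C]_n) :
  corr_num_range A =
  [set ntrace (A *m B) | B in
     [set B : 'M[C]_n | psdmx B /\ forall i, B i i = 1]].
Proof.
rewrite corr_num_rangeE; apply/seteqP; split=> z.
  by move=> [E E1 <-]; exists (E *m E^t*) => //; split=> //; exact: psdmx_gram.
move=> [B [/psdmx_factor[E ->] E1] <-]; by exists E.
Qed.

End PositiveSemidefinite.

(** * The Toeplitz-Hausdorff theorem in homogeneous form *)

Section ToeplitzHausdorff.
Context {R : realType}.
Local Notation C := (complex R).

Lemma exists_left_kernel (F : fieldType) p q (M : 'M[F]_(p, q)) :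
  (q < p)%N -> exists2 r : 'rV_p, r != 0 & r *m M = 0.
Proof.
move=> qp; have : kermx M != 0.
  rewrite kermx_eq0 /row_free neq_ltn; apply/orP; left.
  exact: leq_ltn_trans (rank_leq_col _) qp.
by case/rowV0Pn => r /sub_kermxP rM r0; exists r.
Qed.

(* Moving from the identity along the Hermitian matrix [[p, w], [w^*, q]], with
   w = u + i v, until the first eigenvalue vanishes. *)
Lemma singular_perturbation (p q u v : R) :
  [|| p != 0, q != 0, u != 0 | v != 0] ->
  exists t, [/\ 0 <= 1 + t * p, 0 <= 1 + t * q
    & (1 + t * p) * (1 + t * q) = (t * u) ^+ 2 + (t * v) ^+ 2].
Proof.
(* Negating the direction and [t] together changes nothing, so the trace may be taken nonpositive; a
   nonzero direction then has a negative eigenvalue. *)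
wlog pq : p q u v / p + q <= 0.
  move=> H nz; have [pq|/ltW pq] := leP (p + q) 0; first exact: H.
  have [||t] := H (- p) (- q) (- u) (- v).
  - by rewrite -opprD oppr_le0.
  - by rewrite !oppr_eq0.
  by exists (- t); rewrite !mulNr -!mulrN.
(* [s] is the gap between the two eigenvalues and [- c], with [c] below, is the smaller one, so
   [t = c^-1] makes the perturbed identity singular. *)
move=> nz; pose s := Num.sqrt ((p - q) ^+ 2 + 4 * (u ^+ 2 + v ^+ 2)).
have s_ge0 : 0 <= s := sqrtr_ge0 _.
have s2 : s ^+ 2 = (p - q) ^+ 2 + 4 * (u ^+ 2 + v ^+ 2).
  by rewrite sqr_sqrtr// addr_ge0 ?sqr_ge0// mulr_ge0// addr_ge0 ?sqr_ge0.
pose c := (s - (p + q)) / 2.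
have c_gt0 : 0 < c.
  rewrite lt_neqAle; apply/andP; split; last by rewrite /c; lra.
  apply/eqP => c0; have s0 : s = 0 by move: c0; rewrite /c; lra.
  have pq0 : p + q = 0 by move: c0; rewrite /c; lra.
  move: s2; rewrite s0 => /esym s2.
  have [dp du dv] := And3 (sqr_ge0 (p - q)) (sqr_ge0 u) (sqr_ge0 v).
  have p0 : (p - q) ^+ 2 = 0 by nra.
  have u0 : u ^+ 2 = 0 by nra.
  have v0 : v ^+ 2 = 0 by nra.
  move/eqP: p0; move/eqP: u0; move/eqP: v0.
  rewrite !sqrf_eq0 => /eqP v0 /eqP u0 /eqP p0.
  have pp : p = 0 by lra.
  have qq : q = 0 by lra.
  by move: nz; rewrite pp qq u0 v0 eqxx.
have c0 : c != 0 by rewrite gt_eqF.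
have prod : (1 + c^-1 * p) * (1 + c^-1 * q) = (c^-1 * u) ^+ 2 + (c^-1 * v) ^+ 2.
  have e : (c + p) * (c + q) = u ^+ 2 + v ^+ 2.
    have : 4 * ((c + p) * (c + q)) = s ^+ 2 - (p - q) ^+ 2 by rewrite /c; field.
    by rewrite s2; lra.
  have -> : (1 + c^-1 * p) * (1 + c^-1 * q) = c^-1 ^+ 2 * ((c + p) * (c + q)).
    by field.
  by rewrite e; ring.
(* Two reals with nonnegative sum and product are both nonnegative. *)
have sum_ge0 : 0 <= (1 + c^-1 * p) + (1 + c^-1 * q).
  have -> : (1 + c^-1 * p) + (1 + c^-1 * q) = c^-1 * s.
    by have -> : s = 2 * c + p + q; [rewrite /c|]; field.
  by rewrite mulr_ge0// invr_ge0 ltW.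
have prod_ge0 : 0 <= (1 + c^-1 * p) * (1 + c^-1 * q).
  by rewrite prod; apply: addr_ge0; exact: sqr_ge0.
exists c^-1; split=> //; nra.
Qed.

(** A singular positive semidefinite [[[al, w], [w^*, be]]] is [u u^*] with [u = (a, b)^T]: take [a]
    the square root of [al] and solve for [b], unless [al = 0], which forces [w = 0]. *)
Lemma rank_one_factor (al be : R) (w : C) : 0 <= al -> 0 <= be ->
  (al * be)%:C%C = w * w^* ->
  exists a b : C, [/\ a * a^* = al%:C%C, b * b^* = be%:C%C & a * b^* = w].
Proof.
move=> al_ge0 be_ge0 e.
have sqrtCE (g : R) : 0 <= g -> sqrtC g%:C%C * (sqrtC g%:C%C)^* = g%:C%C.
  move=> g0; have /ger0_real/CrealP -> : 0 <= sqrtC g%:C%C.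
    by rewrite sqrtC_ge0 ler0c.
  by rewrite -expr2 sqrtCK.
have [al0|al0] := eqVneq al 0.
  exists 0, (sqrtC be%:C%C); rewrite sqrtCE// al0 !mul0r; split=> //.
  move: e; rewrite al0 mul0r => /esym/eqP; rewrite mulf_eq0 conjC_eq0 orbb.
  by move/eqP.
have a0 : sqrtC al%:C%C != 0.
  by rewrite sqrtC_eq0 (inj_eq (@complexI _)).
have ar : (sqrtC al%:C%C)^* = sqrtC al%:C%C.
  by apply/CrealP/ger0_real; rewrite sqrtC_ge0 ler0c.
exists (sqrtC al%:C%C), (w^* / sqrtC al%:C%C); rewrite sqrtCE//.
rewrite rmorphM fmorphV/= ar conjCK; split=> //; last by rewrite mulrC divfK.
apply: (@mulfI _ (al%:C%C)); first by rewrite (inj_eq (@complexI _)).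
rewrite -[RHS]rmorphM/= e -[X in X * _ = _](sqrtCE _ al_ge0) ar.
by move: (sqrtC _) a0 => g g0; field.
Qed.

Lemma inner_lincomb m (a b : C) (x y u v : 'cV[C]_m) :
  inner (a *: x + b *: y) (a *: u + b *: v) =
  a * a^* * inner x u + a * b^* * inner x v +
    (b * a^* * inner y u + b * b^* * inner y v).
Proof.
rewrite innerDl !innerDr !innerZl !innerZr.
move: (inner x u) (inner x v) (inner y u) (inner y v) (Num.conj a) (Num.conj b).
by move=> *; rewrite !mulrA.
Qed.

Lemma quad_form_add m (T : 'M[C]_m) (x y : 'cV[C]_m) :
  exists2 z, inner (T *m z) z = inner (T *m x) x + inner (T *m y) y
    & inner z z = inner x x + inner y y.
Proof.
(* [h] lists the coefficients of [p], [q], [Re w], [Im w] in [p a11 + q a22 + w a12 + w^* a21], the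
   pairing of the Hermitian matrix [[[p, w], [w^*, q]]] with the given values. *)
pose h (a11 a12 a21 a22 : C) (i : 'I_4) : C :=
  nth 0 [:: a11; a22; a12 + a21; 'i * (a12 - a21)] i.
pose hT := h (inner (T *m x) x) (inner (T *m x) y) (inner (T *m y) x)
  (inner (T *m y) y).
pose h1 := h (inner x x) (inner x y) (inner y x) (inner y y).
(* Four real unknowns, three real equations: the pairing with [hT] contributes two, while the one
   with [h1] is already real. *)
have [r r0 rM] := @exists_left_kernel _ 4 3 (\matrix_(i, j)
  nth 0 [:: complex.Re (hT i); complex.Im (hT i); complex.Re (h1 i)] j) isT.
have hreal a11 a12 a21 a22 : a11^* = a11 -> a21 = a12^* -> a22^* = a22 ->
    forall i, complex.Im (h a11 a12 a21 a22 i) = 0.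
  move=> r11 -> r22 i; suff : h a11 a12 a12^* a22 i \is Num.real.
    by case: (h _ _ _ _ i) => u v; rewrite complex_real => /eqP.
  rewrite /h; case: i => -[|[|[|[|//]]]] /= _; apply/CrealP => //.
    by rewrite rmorphD/= conjCK addrC.
  by rewrite rmorphM/= conjCi rmorphB/= conjCK mulNr -mulrN opprB.
have h1real i : complex.Im (h1 i) = 0.
  by apply: hreal; rewrite -inner_conj.
have sumRe (f : 'I_4 -> C) : complex.Re (\sum_i (r 0 i)%:C%C * f i) =
    \sum_i r 0 i * complex.Re (f i).
  rewrite (big_morph (@complex.Re R) (id1 := 0) (op1 := +%R))//; last first.
    by move=> [? ?] [? ?].
  by apply: eq_bigr => i _; case: (f i) => a b /=; rewrite mul0r subr0.
have sumIm (f : 'I_4 -> C) : complex.Im (\sum_i (r 0 i)%:C%C * f i) =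
    \sum_i r 0 i * complex.Im (f i).
  rewrite (big_morph (@complex.Im R) (id1 := 0) (op1 := +%R))//; last first.
    by move=> [? ?] [? ?].
  by apply: eq_bigr => i _; case: (f i) => a b /=; rewrite mul0r addr0.
have rj (j : 'I_3) := congr1 (fun M : 'rV_3 => M 0 j) rM.
have hT0 : \sum_i (r 0 i)%:C%C * hT i = 0.
  apply/eqP; rewrite eq_complex sumRe sumIm; apply/andP; split; apply/eqP.
    by have := rj 0; rewrite /= !mxE => e; rewrite -[RHS]e;
      apply: eq_bigr => i _; rewrite mxE.
  by have := rj 1; rewrite /= !mxE => e; rewrite -[RHS]e;
      apply: eq_bigr => i _; rewrite mxE.
have h10 : \sum_i (r 0 i)%:C%C * h1 i = 0.
  apply/eqP; rewrite eq_complex sumRe sumIm; apply/andP; split; apply/eqP.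
    by have := rj 2; rewrite /= !mxE => e; rewrite -[RHS]e;
      apply: eq_bigr => i _; rewrite mxE.
  by rewrite big1// => i _; rewrite h1real mulr0.
pose r_ k := r 0 (inord k).
have [|t [al be prod]] := @singular_perturbation (r_ 0) (r_ 1) (r_ 2) (r_ 3).
  apply: contraNT r0; rewrite !negb_or !negbK.
  move=> /and4P[/eqP e0 /eqP e1 /eqP e2 /eqP e3].
  apply/eqP/rowP => i; rewrite mxE -(inord_val i).
  by case: i => -[|[|[|[|//]]]].
(* The off-diagonal entry of the singular matrix [1 + t H], where [H] is the Hermitian matrix with
   coordinates [r]. *)
pose w : C := (t * r_ 2)%:C%C + 'i * (t * r_ 3)%:C%C.
have wJ : w^* = (t * r_ 2)%:C%C - 'i * (t * r_ 3)%:C%C.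
  have realJ (g : R) : (g%:C%C)^* = g%:C%C :> C.
    by apply/CrealP; apply/complex_realP; exists g.
  by rewrite rmorphD rmorphM/= conjCi !realJ mulNr.
have [|a [b [aa bb ab]]] := @rank_one_factor _ _ w al be.
  rewrite prod wJ /w [LHS]rmorphD !rmorphXn/=.
  by rewrite [RHS]mulrC -subr_sqr exprMn sqrCi mulN1r opprK.
have ba : b * a^* = w^* by rewrite -ab rmorphM/= conjCK mulrC.
(* When [H] pairs to zero, [u u^* = 1 + t H] with [u = (a, b)^T] has the same pairing as the
   identity. *)
have expand (a11 a12 a21 a22 : C) :
    \sum_i (r 0 i)%:C%C * h a11 a12 a21 a22 i = 0 ->
    a * a^* * a11 + a * b^* * a12 + (b * a^* * a21 + b * b^* * a22) = a11 + a22.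
  rewrite aa bb ab ba wJ /w !big_ord_recl big_ord0 /h /= => e.
  have rE (i : 'I_4) k : i = k :> nat -> r 0 i = r_ k.
    by move=> <-; rewrite /r_ inord_val.
  move: e; rewrite (rE _ 0)// (rE _ 1)// (rE _ 2)// (rE _ 3)//.
  rewrite !rmorphD !rmorphM !rmorph1 => e.
  have := congr1 ( *%R t%:C%C) e; rewrite mulr0 => {}e.
  by apply/eqP; rewrite -subr_eq0 -e; apply/eqP; ring.
exists (a *: x + b *: y).
  by rewrite mulmxDr -!scalemxAr inner_lincomb; apply: expand; exact: hT0.
by rewrite inner_lincomb; apply: expand; exact: h10.
Qed.

Lemma quad_form_sum m (T : 'M[C]_m) n (x : 'I_n -> 'cV[C]_m) :
  exists2 z, inner (T *m z) z = \sum_i inner (T *m x i) (x i)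
    & inner z z = \sum_i inner (x i) (x i).
Proof.
pose K (a b : C) := exists2 z, inner (T *m z) z = a & inner z z = b.
apply: (big_ind2 K) => [|a b a' b' [z <- <-] [z' <- <-]|i _].
- by exists 0; rewrite innerE big1// => i _; rewrite !mxE ?mulmx0 ?conjC0 mulr0.
- exact: quad_form_add.
- by exists (x i).
Qed.

Lemma mxtrace_gram m n (T : 'M[C]_m) (E : 'M[C]_(m, n)) :
  \tr (T *m (E *m E^t*)) = \sum_i inner (T *m col i E) (col i E).
Proof.
rewrite mulmxA mxtrace_mulC; apply: eq_bigr => c _.
rewrite colE mulmxA -!colE mxE innerE; apply: eq_bigr => k _.
by rewrite !mxE mulrC.
Qed.

(** The squared norms of the columns of [E] add up to the trace of [E *m E^t*], that is [n], so the
    vector given by [quad_form_sum] is divided by the square root of [n]. *)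
Lemma corr_num_range_sub n (A : 'M[C]_n) : (0 < n)%N ->
  corr_num_range A `<=` num_range A.
Proof.
move=> n_gt0; rewrite corr_num_rangeE => _ [E E1 <-].
have [z Tz zz] := quad_form_sum A (fun i => col i E).
have nC : `|(sqrtC n%:R)^-1| ^+ 2 = n%:R^-1 :> C.
  by rewrite normfV ger0_norm ?sqrtC_ge0 ?ler0n// exprVn sqrtCK.
exists ((sqrtC n%:R)^-1 *: z).
  apply/norm2_eq1; rewrite innerZl innerZr mulrA -normCK nC zz.
  under eq_bigr => i _ do rewrite -{1}(mul1mx (col i E)).
  rewrite -mxtrace_gram mul1mx /mxtrace.
  rewrite (eq_bigr (fun=> 1)) => [|i _]; last exact: E1.
  by rewrite sumr_const card_ord mulVf// pnatr_eq0 -lt0n.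
by rewrite -scalemxAr innerZl innerZr mulrA -normCK nC Tz -mxtrace_gram.
Qed.

End ToeplitzHausdorff.

(** * The normalized trace *)

Section NormalizedTrace.
Context {R : realType}.
Local Notation C := (complex R).

Lemma ntraceD n (A B : 'M[C]_n) : ntrace (A + B) = ntrace A + ntrace B.
Proof. by rewrite /ntrace mxtraceD mulrDr. Qed.

Lemma ntraceZ n (a : C) (A : 'M[C]_n) : ntrace (a *: A) = a * ntrace A.
Proof. by rewrite /ntrace mxtraceZ mulrCA. Qed.

(** The off-diagonal entries of [G] meet zeros of [D]. This gives the translation rule and the easy
    half of the singleton criterion. *)
Lemma ntrace_diag_mulmx n (D G : 'M[C]_n) : is_diag_mx D ->
  (forall i, G i i = 1) -> ntrace (D *m G) = ntrace D.
Proof.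
move=> /is_diag_mxP D0 G1; rewrite ntraceE /ntrace; congr (_ * _).
apply: eq_bigr => i _; rewrite (bigD1 i)//= big1 ?addr0 ?G1 ?mulr1// => j ji.
by rewrite D0 ?mul0r// eq_sym.
Qed.

Lemma mxtrace_mul_delta n (A : 'M[C]_n) i j : \tr (A *m delta_mx j i) = A i j.
Proof.
rewrite /mxtrace (bigD1 i)//= mxE (bigD1 j)//= !mxE !eqxx mulr1.
rewrite big1 ?addr0 => [|k kj]; last by rewrite !mxE (negPf kj) mulr0.
rewrite big1 ?addr0// => k ki; rewrite mxE big1// => l _.
by rewrite !mxE (negPf ki) andbF mulr0.
Qed.

Lemma mxtrace_conj n (A : 'M[C]_n) : \tr (A^t*) = (\tr A)^*.
Proof. by rewrite /mxtrace rmorph_sum; apply: eq_bigr => i _; rewrite !mxE. Qed.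

(** For Hermitian [B], the trace of [A^t* B] is the conjugate of that of [A B]. *)
Lemma ntrace_Im_mulmx n (A B : 'M[C]_n) : B^t* = B ->
  ntrace (Im_mx A *m B) =
  (2 * 'i)^-1 * (ntrace (A *m B) - (ntrace (A *m B))^*).
Proof.
move=> BB; rewrite /Im_mx -scalemxAl ntraceZ; congr (_ * _).
rewrite mulmxBl {1}/ntrace raddfB /= mulrBr; congr (_ - _).
rewrite /ntrace rmorphM/= fmorphV/= rmorph_nat; congr (_ * _).
by rewrite -mxtrace_conj trmx_mul map_mxM BB mxtrace_mulC.
Qed.

End NormalizedTrace.

(** * Convexity, translation, transposition, singleton and reality criteria *)

Section CorrelationRangeProperties.
Context {R : realType}.
Local Notation C := (complex R).

(** Convexity is stated in the real vector space [Rcomplex R]; this turns its combinations into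
    products in [C]. *)
Lemma conv_Rcomplex (l : {i01 R}) (z z' : C) :
  conv l (z : convex_lmodType (Rcomplex R)) z' =
  (l%:num)%:C%C * z + (1 - l%:num)%:C%C * z' :> C.
Proof.
by case: z => a b; case: z' => c d; apply/eqP;
  rewrite eq_complex /= !mul0r !subr0 !addr0 !eqxx.
Qed.

Lemma corr_num_range_convex n (A : 'M[C]_n) :
  convex_set (corr_num_range A : set (convex_lmodType (Rcomplex R))).
Proof.
move=> z z' l; rewrite !inE corr_num_range_psd.
move=> [B [B_ge0 B1] <-] [B' [B'_ge0 B'1] <-].
have l_ge0 : 0 <= (l%:num)%:C%C :> C by rewrite ler0c.
have l'_ge0 : 0 <= (1 - l%:num)%:C%C :> C by rewrite ler0c subr_ge0.
exists ((l%:num)%:C%C *: B + (1 - l%:num)%:C%C *: B').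
  split=> [x|i].
    by rewrite mulmxDl -!scalemxAl innerDl !innerZl addr_ge0// mulr_ge0.
  by rewrite !mxE B1 B'1 !mulr1 -rmorphD/= addrC subrK.
by rewrite conv_Rcomplex mulmxDr -!scalemxAr ntraceD !ntraceZ.
Qed.

Lemma ntrace_corr_num_range n (A : 'M[C]_n) : corr_num_range A (ntrace A).
Proof.
rewrite corr_num_rangeE; exists 1%:M => [i|].
  by rewrite trmx1 map_mx1 mulmx1 mxE eqxx.
by rewrite trmx1 map_mx1 !mulmx1.
Qed.

Lemma corr_num_range_add_diag n (A D : 'M[C]_n) : is_diag_mx D ->
  corr_num_range (A + D) = [set z + ntrace D | z in corr_num_range A].
Proof.
move=> Ddiag; rewrite !corr_num_rangeE; apply/seteqP; split=> z.
  move=> [E E1 <-]; exists (ntrace (A *m (E *m E^t*))); first by exists E.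
  by rewrite mulmxDl ntraceD (ntrace_diag_mulmx Ddiag E1).
move=> [_ [E E1 <-] <-]; exists E => //.
by rewrite mulmxDl ntraceD (ntrace_diag_mulmx Ddiag E1).
Qed.

(** Conjugating [E] transposes its Gram matrix, and the trace is invariant under transposition. One
    inclusion for every matrix suffices, transposition being an involution. *)
Lemma corr_num_range_tr n (A : 'M[C]_n) : corr_num_range A^T = corr_num_range A.
Proof.
suff sub (M : 'M[C]_n) : corr_num_range M^T `<=` corr_num_range M.
  apply/seteqP; split; first exact: sub.
  by have := sub (A^T); rewrite trmxK.
rewrite !corr_num_rangeE => z [E E1 <-]; pose E' : 'M[C]_n := map_mx Num.conj E.
have E'E : E' *m E'^t* = (E *m E^t*)^T.
  rewrite trmx_mul; congr (_ *m _); apply/matrixP => i j; rewrite !mxE//.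
  by rewrite conjCK.
exists E'; first by move=> i; rewrite E'E mxE.
rewrite E'E /ntrace; congr (_ * _).
by move: (E *m E^t*) => G; rewrite -[RHS]mxtrace_tr trmx_mul trmxK mxtrace_mulC.
Qed.

(** [E] is the identity with row [j] replaced by [th] times row [i]: its rows stay unit vectors, and
    only rows [i] and [j] fail to be orthogonal. *)
Lemma gram_delta n (i j : 'I_n) (th : C) : i != j -> th * th^* = 1 ->
  let E := 1%:M - delta_mx j j + th *: delta_mx j i in
  E *m E^t* = 1%:M + th *: delta_mx j i + th^* *: delta_mx i j.
Proof.
move=> ij th1 /=; have ji : j != i by rewrite eq_sym.
rewrite !(linearD, linearN, linearZ)/= trmx1 !trmx_delta.
rewrite !(map_mxD, map_mxN, map_mxZ) map_mx1 !map_delta_mx.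
rewrite !mulmxDl !mulmxDr !mulNmx !mulmxN !mul1mx !mulmx1.
rewrite -!scalemxAl -!scalemxAr !mul_delta_mx_cond !eqxx.
rewrite (negPf ij) (negPf ji) !mulr1n !mulr0n !scaler0 scalerA th1 scale1r.
move: (delta_mx j j) (th *: delta_mx j i) (th^* *: delta_mx i j) => X Y Z.
by apply/matrixP => k l; rewrite !mxE; ring.
Qed.

Lemma corr_num_range_singleton n (A : 'M[C]_n) (la : C) :
  corr_num_range A = [set la] <-> is_diag_mx A /\ ntrace A = la.
Proof.
split=> [A_la|[Adiag <-]]; last first.
  apply/seteqP; split=> z; last by move=> ->; exact: ntrace_corr_num_range.
  by rewrite corr_num_rangeE => -[E E1 <-]; rewrite (ntrace_diag_mulmx Adiag E1).
have trA : ntrace A = la by have := ntrace_corr_num_range A; rewrite A_la.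
split=> //; apply/is_diag_mxP => i j; rewrite (inj_eq val_inj) => ij.
(* The values at the Gram matrix of [gram_delta] and at the identity must agree; they differ by this
   sum divided by [n]. *)
have key (th : C) : th * th^* = 1 -> th * A i j + th^* * A j i = 0.
  move=> th1; have /= EE := gram_delta ij th1.
  set E := (X in X *m _ = _) in EE.
  have : corr_num_range A (ntrace (A *m (E *m E^t*))).
    rewrite corr_num_rangeE; exists E => // k; rewrite EE !mxE eqxx.
    case: (eqVneq k j) => [->|kj]; rewrite /= ?mulr0n ?mulr0 ?addr0.
      by rewrite eq_sym (negPf ij)/= !mulr0n !mulr0 !addr0.
    by rewrite andbF mulr0n mulr0 addr0.
  rewrite A_la EE -trA /= !mulmxDr mulmx1 -!scalemxAr !ntraceD !ntraceZ.
  rewrite -addrA -[RHS]addr0 => /addrI /eqP.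
  rewrite /ntrace !mxtrace_mul_delta !(mulrCA _ n%:R^-1) -mulrDr mulf_eq0.
  rewrite invr_eq0 pnatr_eq0; case/orP => [|/eqP//].
  (* [n] is nonzero since it bounds the index [i]. *)
  by rewrite gtn_eqF//; exact: leq_ltn_trans (leq0n i) (ltn_ord i).
(* [th = 1] kills the sum of [A i j] and [A j i], [th = 'i] their difference. *)
have := key 1; rewrite conjC1 !mul1r => /(_ erefl) e1.
have := key 'i; rewrite conjCi mulrN -expr2 sqrCi opprK => /(_ erefl).
rewrite mulNr -mulrBr => /eqP; rewrite mulf_eq0 (negPf (neq0Ci _))/= => /eqP e2.
have : 2 * A i j = 0 by rewrite -[RHS]addr0 -{1}e1 -e2; ring.
by move/eqP; rewrite mulf_eq0 pnatr_eq0 => /eqP.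
Qed.

Lemma corr_num_range_Im n (A : 'M[C]_n) :
  corr_num_range (Im_mx A) =
  [set (2 * 'i)^-1 * (z - z^*) | z in corr_num_range A].
Proof.
have herm (E : 'M[C]_n) : (E *m E^t*)^t* = E *m E^t*.
  exact/psdmx_hermitian/psdmx_gram.
rewrite !corr_num_rangeE; apply/seteqP; split=> z.
  move=> [E E1 <-]; rewrite ntrace_Im_mulmx//.
  by exists (ntrace (A *m (E *m E^t*))) => //; exists E.
by move=> [_ [E E1 <-] <-]; exists E => //; rewrite ntrace_Im_mulmx.
Qed.

Lemma corr_num_range_real n (A : 'M[C]_n) :
  corr_num_range A `<=` [set z : C | z \is Num.real] <->
  is_diag_mx (Im_mx A) /\ ntrace (Im_mx A) = 0.
Proof.
rewrite -corr_num_range_singleton corr_num_range_Im.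
have i2 : (2 * 'i)^-1 != 0 :> C.
  by rewrite invr_eq0 mulf_neq0 ?neq0Ci ?pnatr_eq0.
split=> [Areal|A0 z Az /=].
  have z0 z : corr_num_range A z -> (2 * 'i)^-1 * (z - z^*) = 0.
    by move=> /Areal /CrealP ->; rewrite subrr mulr0.
  apply/seteqP; split=> z; first by move=> [y Ay <-]; exact: z0.
  (* Equality with the singleton also needs a point of the range. *)
  by move=> ->; exists (ntrace A); [|apply: z0]; exact: ntrace_corr_num_range.
have : [set (2 * 'i)^-1 * (z - z^*) | z in corr_num_range A]
  ((2 * 'i)^-1 * (z - z^*)) by exists z.
rewrite A0 /= => /eqP; rewrite mulf_eq0 (negPf i2)/= subr_eq0 => /eqP e.
by apply/CrealP; rewrite -e.
Qed.

End CorrelationRangeProperties.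

(** * Continuity of complex-valued maps *)

Section ComplexContinuity.
Context {R : realType} {T : topologicalType}.
Local Notation C := (complex R).

(** Splitting into real and imaginary parts gives access to closed preimages and the extreme value
    theorem for real functions. *)
Definition Ccontinuous (f : T -> C) :=
  continuous (fun x => complex.Re (f x)) /\ continuous (fun x => complex.Im (f x)).

Lemma Ccontinuous_cst (c : C) : Ccontinuous (fun=> c).
Proof. by split; exact: cst_continuous. Qed.

Lemma CcontinuousD (f g : T -> C) :
  Ccontinuous f -> Ccontinuous g -> Ccontinuous (fun x => f x + g x).
Proof.
move=> [fR fI] [gR gI].
have eR : (fun x => complex.Re (f x + g x)) =
    (fun x => complex.Re (f x) + complex.Re (g x)).
  by apply/funext => x; case: (f x) => ? ?; case: (g x).
have eI : (fun x => complex.Im (f x + g x)) =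
    (fun x => complex.Im (f x) + complex.Im (g x)).
  by apply/funext => x; case: (f x) => ? ?; case: (g x).
rewrite /Ccontinuous eR eI; split=> x; apply: cvgD;
  [exact: fR|exact: gR|exact: fI|exact: gI].
Qed.

Lemma CcontinuousM (f g : T -> C) :
  Ccontinuous f -> Ccontinuous g -> Ccontinuous (fun x => f x * g x).
Proof.
move=> [fR fI] [gR gI].
have eR : (fun x => complex.Re (f x * g x)) = (fun x =>
    complex.Re (f x) * complex.Re (g x) - complex.Im (f x) * complex.Im (g x)).
  by apply/funext => x; case: (f x) => ? ?; case: (g x).
have eI : (fun x => complex.Im (f x * g x)) = (fun x =>
    complex.Re (f x) * complex.Im (g x) + complex.Im (f x) * complex.Re (g x)).
  by apply/funext => x; case: (f x) => ? ?; case: (g x).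
rewrite /Ccontinuous eR eI; split=> x.
  by apply: cvgB; apply: cvgM; [exact: fR|exact: gR|exact: fI|exact: gI].
by apply: cvgD; apply: cvgM; [exact: fR|exact: gI|exact: fI|exact: gR].
Qed.

Lemma Ccontinuous_sum (I : finType) (f : I -> T -> C) :
  (forall i, Ccontinuous (f i)) -> Ccontinuous (fun x => \sum_i f i x).
Proof.
move=> fC; suff : Ccontinuous (\sum_i f i).
  by rewrite (_ : \sum_i f i = fun x => \sum_i f i x)//; apply/funext => x;
    rewrite fct_sumE.
apply: (big_ind Ccontinuous) => [|g h|i _]; last exact: fC.
  exact: Ccontinuous_cst.
exact: CcontinuousD.
Qed.

End ComplexContinuity.

(** * Compactness of the matrices with unit rows, closedness of the range *)

Section RealCoordinates.
Context {R : realType} {n : nat}.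
Local Notation C := (complex R).
Local Notation N := (n * n + n * n)%N.

(** Real parts fill the first [n * n] coordinates and imaginary parts the rest, so that compactness
    is a matter of real row vectors. *)
Definition mx_of_coords (v : 'rV[R]_N) : 'M[C]_n :=
  \matrix_(i, j) (v ord0 (lshift (n * n) (mxvec_index i j)) +i*
                  v ord0 (rshift (n * n) (mxvec_index i j)))%C.

Lemma mx_of_coords_surj (E : 'M[C]_n) : exists v, mx_of_coords v = E.
Proof.
exists (row_mx (mxvec (map_mx (@complex.Re R) E))
  (mxvec (map_mx (@complex.Im R) E))).
apply/matrixP => i j; rewrite mxE row_mxEl row_mxEr !mxvecE !mxE.
by case: (E i j).
Qed.

Lemma Ccontinuous_gram i j :
  Ccontinuous (fun v : 'rV[R]_N => (mx_of_coords v *m (mx_of_coords v)^t*) i j).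
Proof.
under eq_fun => v do rewrite mxE.
apply: Ccontinuous_sum => k; apply: CcontinuousM.
  under eq_fun => v do rewrite mxE.
  by split=> v /=; exact: coord_continuous.
under eq_fun => v do rewrite !mxE -[Num.conj _]/(conjc _).
split=> v /=; first exact: coord_continuous.
exact: (cvgN (@coord_continuous R 1 N ord0 (rshift (n * n) (mxvec_index j k)) v)).
Qed.

Lemma gram_diag_sum (E : 'M[C]_n) i : (E *m E^t*) i i = \sum_k `|E i k| ^+ 2.
Proof. by rewrite mxE; apply: eq_bigr => k _; rewrite !mxE normCK. Qed.

Lemma gram_diag_entry_le1 (E : 'M[C]_n) i k : (E *m E^t*) i i = 1 ->
  `|E i k| <= 1.
Proof.
rewrite gram_diag_sum (bigD1 k)//= => e.
rewrite -(@expr_le1 _ 2)// -e lerDl.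
by apply: sumr_ge0 => j _; rewrite exprn_ge0.
Qed.

(** Closed by continuity of the diagonal Gram entries, and contained in a product of segments
    because the entries of a unit row have modulus at most 1. *)
Lemma compact_unit_rows :
  compact [set v : 'rV[R]_N |
    forall i, (mx_of_coords v *m (mx_of_coords v)^t*) i i = 1].
Proof.
pose box := [set v : 'rV[R]_N | forall k, `[-1, 1]%classic (v ord0 k)].
apply: (@subclosed_compact _ _ box).
- have -> : [set v : 'rV[R]_N |
      forall i, (mx_of_coords v *m (mx_of_coords v)^t*) i i = 1] =
    \bigcap_(i in setT)
     (((fun v => complex.Re ((mx_of_coords v *m (mx_of_coords v)^t*) i i)) @^-1`
       [set x | x = 1]) `&`
     ((fun v => complex.Im ((mx_of_coords v *m (mx_of_coords v)^t*) i i)) @^-1`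
       [set x | x = 0])).
    apply/seteqP; split=> v /=.
      by move=> H i _; split; rewrite /= H.
    move=> H i; have [/= HR HI] := H i I.
    by apply/eqP; rewrite eq_complex HR HI !eqxx.
  apply: closed_bigI => i _; have [cR cI] := Ccontinuous_gram i i.
  by apply: closedI; apply: preimage_closed; [| exact: closed_eq | |
    exact: closed_eq] => v _; [exact: cR|exact: cI].
- apply: (@rV_compact R _ (fun=> `[(-1 : R), 1]%classic)) => _; exact: segment_compact.
move=> v v1 k /=.
suff [i [j kE]] : exists i j, `|v ord0 k|%:C%C <= `|mx_of_coords v i j|.
  have := le_trans kE (gram_diag_entry_le1 j (v1 i)).
  by rewrite (lecR _ 1) ler_norml in_itv.
case: (split_ordP k) => l ->; case/mxvec_indexP: l => i j.
  exists i, j; apply: le_trans (normc_ge_Re _).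
  by rewrite mxE.
exists i, j; rewrite normc_def lecR mxE /= -sqrtr_sqr ler_wsqrtr// lerDr.
exact: sqr_ge0.
Qed.

(** The distance to [l] attains its minimum over the compact set of unit-row matrices, and values
    arbitrarily close to [l] force that minimum to be zero. *)
Lemma corr_num_range_closed (A : 'M[C]_n) (l : C) :
  (forall e : R, 0 < e -> exists2 z, corr_num_range A z & `|z - l| < e%:C%C) ->
  corr_num_range A l.
Proof.
move=> near_l.
pose K := [set v : 'rV[R]_N |
  forall i, (mx_of_coords v *m (mx_of_coords v)^t*) i i = 1].
pose g (v : 'rV[R]_N) := ntrace (A *m (mx_of_coords v *m (mx_of_coords v)^t*))
  - l.
have [gR gI] : Ccontinuous g.
  apply: CcontinuousD; last exact: Ccontinuous_cst.
  under eq_fun => v do rewrite ntraceE.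
  apply: CcontinuousM; first exact: Ccontinuous_cst.
  apply: Ccontinuous_sum => i; apply: Ccontinuous_sum => j.
  apply: CcontinuousM; first exact: Ccontinuous_cst.
  exact: Ccontinuous_gram.
pose f v := complex.Re (g v) * complex.Re (g v) + complex.Im (g v) * complex.Im (g v).
have fE v : (f v)%:C%C = `|g v| ^+ 2 by rewrite -add_Re2_Im2 !expr2.
have fC : continuous f.
  by move=> v; exact: (cvgD (cvgM (gR v) (gR v)) (cvgM (gI v) (gI v))).
have approx e : 0 < e -> exists2 v, K v & `|g v| < e%:C%C.
  move=> /near_l[z]; rewrite corr_num_rangeE => -[E E1 <-] lt_e.
  have [v vE] := mx_of_coords_surj E.
  by exists v; rewrite /K /g /= vE.
have K0 : K !=set0 by have [v Kv _] := approx 1 ltr01; exists v.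
have [v Kv vmin] := EVT_min_rV K0 compact_unit_rows (continuous_subspaceT fC).
have g0 : g v = 0.
  apply/eqP; rewrite -normr_eq0 -sqrf_eq0 -fE; apply/eqP.
  have f_ge0 : 0 <= f v by rewrite -ler0c fE exprn_ge0.
  have [fv|fv] := eqVneq (f v) 0; first by rewrite fv.
  have fv_gt0 : 0 < f v by rewrite lt_neqAle eq_sym fv.
  (* A positive minimum [f v] would be beaten by a point where the modulus of [g] is below the
     square root of [f v]. *)
  have [|w Kw gw] := approx (Num.sqrt (f v)); first by rewrite sqrtr_gt0.
  have := vmin w; rewrite inE => /(_ Kw); rewrite leNgt => /negP[].
  have sE : (f v)%:C%C = (Num.sqrt (f v))%:C%C ^+ 2.
    by rewrite -rmorphXn/= sqr_sqrtr.
  rewrite -ltcR [X in X < _](fE w) [X in _ < X]sE.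
  by rewrite ltrXn2r// nnegrE ler0c sqrtr_ge0.
rewrite corr_num_rangeE; exists (mx_of_coords v); first by move: Kv; rewrite inE.
by apply/eqP; rewrite -subr_eq0; apply/eqP.
Qed.

End RealCoordinates.

(** * Operator norm estimates and the limit statement *)

Section Limits.
Context {R : realType}.
Local Notation C := (complex R).

Lemma norm2_le m (x : 'cV[C]_m) (M : R) :
  inner x x <= M%:C%C -> norm2 x <= Num.sqrt M.
Proof. by rewrite lecE => /andP[_ ?]; exact: ler_wsqrtr. Qed.

Lemma inner_normE m (x : 'cV[C]_m) : inner x x = \sum_k `|x k 0| ^+ 2.
Proof. by rewrite innerE; apply: eq_bigr => k _; rewrite normCK. Qed.

(** Needed for the [sup] in [opnorm] to dominate its set. At a unit vector [x], coordinate [k] of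
    [T *m x] is at most the [k]-th absolute row sum of [T]. *)
Lemma has_ubound_opnorm m (T : 'M[C]_m) :
  has_ubound [set norm2 (T *m x) | x in [set x : 'cV[C]_m | norm2 x = 1]].
Proof.
pose M : C := \sum_k (\sum_j `|T k j|) ^+ 2.
exists (Num.sqrt (complex.Re M)) => _ [x /norm2_eq1 x1 <-]; apply: norm2_le.
have M_ge0 : 0 <= M.
  by apply: sumr_ge0 => k _; rewrite exprn_ge0// sumr_ge0.
rewrite (RRe_real (ger0_real M_ge0)) inner_normE; apply: ler_sum => k _.
rewrite lerXn2r// ?nnegrE ?sumr_ge0// mxE; apply: le_trans (ler_norm_sum _ _ _) _.
apply: ler_sum => j _; rewrite normrM ler_piMr//.
rewrite -(@expr_le1 _ 2)// -x1 inner_normE (bigD1 j)//= lerDl.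
by apply: sumr_ge0 => i _; rewrite exprn_ge0.
Qed.

(** [T i j] is coordinate [i] of the image of the [j]-th basis vector. *)
Lemma entry_le_opnorm m (T : 'M[C]_m) i j : `|T i j| <= (opnorm T)%:C%C.
Proof.
have e1 : norm2 (delta_mx j 0 : 'cV[C]_m) = 1.
  apply/norm2_eq1; rewrite inner_normE (bigD1 j)//= mxE !eqxx normr1 expr1n.
  by rewrite big1 ?addr0// => k kj; rewrite mxE (negPf kj) normr0 expr0n.
have le_op : norm2 (T *m delta_mx j 0) <= opnorm T.
  by apply: ub_le_sup; [exact: has_ubound_opnorm|exists (delta_mx j 0)].
have nn : 0 <= norm2 (T *m delta_mx j 0) by exact: sqrtr_ge0.
apply: le_trans (_ : (norm2 (T *m delta_mx j 0))%:C%C <= _); last by rewrite lecR.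
rewrite -(@ler_pXn2r _ 2)// ?nnegrE ?ler0c// normC_norm2 inner_normE -colE.
rewrite (bigD1 i)//= mxE lerDl.
by apply: sumr_ge0 => k _; rewrite exprn_ge0.
Qed.

(** A crude constant suffices: each Gram entry is a sum of [n] products of modulus at most 1, so the
    double sum has [n ^ 2] terms of size at most [n * opnorm T], and the trace is divided by [n]. *)
Lemma norm_ntrace_le n (T E : 'M[C]_n) : (forall i, (E *m E^t*) i i = 1) ->
  `|ntrace (T *m (E *m E^t*))| <= ((n ^ 2)%:R * opnorm T)%:C%C.
Proof.
move=> E1; case: n => [|n] in T E E1 *.
  by rewrite /ntrace /mxtrace big_ord0 mulr0 normr0 mul0r.
have gram_le i j : `|(E *m E^t*) i j| <= n.+1%:R.
  rewrite mxE; apply: le_trans (ler_norm_sum _ _ _) _.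
  rewrite -[leRHS]mulr1 mulr_natl -[in leRHS](card_ord n.+1) -sumr_const.
  apply: ler_sum => k _; rewrite !mxE normrM norm_conjC mulr_ile1//;
    exact: gram_diag_entry_le1.
rewrite ntraceE normrM normfV normr_nat ler_pdivrMl ?ltr0n//.
have -> : n.+1%:R * ((n.+1 ^ 2)%:R * opnorm T)%:C%C =
    \sum_(i < n.+1) \sum_(j < n.+1) (opnorm T)%:C%C * n.+1%:R.
  rewrite !sumr_const card_ord -[RHS]mulr_natl -[X in _ = _ * X]mulr_natl.
  rewrite rmorphM/= rmorph_nat natrX.
  by rewrite expr2; move: (n.+1%:R : C) (opnorm T)%:C%C => a b; ring.
apply: le_trans (ler_norm_sum _ _ _) _; apply: ler_sum => i _.
apply: le_trans (ler_norm_sum _ _ _) _; apply: ler_sum => j _.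
by rewrite normrM ler_pM// entry_le_opnorm.
Qed.

(** The values of [Ak k] and [A] at the same [E] are close, uniformly in [E]. One inclusion keeps
    [E] fixed; in the other, values of [A] approach the limit and closedness concludes. *)
Lemma corr_num_range_limit n (A : 'M[C]_n) (Ak : nat -> 'M[C]_n) :
  opnorm (Ak k - A) @[k --> \oo] --> (0 : R) ->
  corr_num_range A =
    [set l : C | exists lambda : nat -> C,
       (forall k, corr_num_range (Ak k) (lambda k)) /\
       lambda k @[k --> \oo] --> (l : C^o)].
Proof.
move=> /cvgr0Pnorm_lt Ak_cvg.
have close e : 0 < e -> exists N, forall k, (N <= k)%N -> forall E : 'M[C]_n,
    (forall i, (E *m E^t*) i i = 1) ->
    `|ntrace (Ak k *m (E *m E^t*)) - ntrace (A *m (E *m E^t*))| < e%:C%C.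
  (* The [+ 1] keeps the divisor positive even when [n = 0]. *)
  move=> e_gt0; have n2 : 0 < (n ^ 2)%:R + 1 :> R by rewrite ltr_wpDl.
  have [N _ HN] := Ak_cvg (e / ((n ^ 2)%:R + 1)) (divr_gt0 e_gt0 n2).
  exists N => k Nk E E1.
  have {HN} := HN k Nk; rewrite /= ltr_pdivlMr// => HN.
  have -> : ntrace (Ak k *m (E *m E^t*)) - ntrace (A *m (E *m E^t*)) =
      ntrace ((Ak k - A) *m (E *m E^t*)).
    by rewrite mulmxBl /ntrace raddfB/= mulrBr.
  apply: le_lt_trans (norm_ntrace_le _ E1) _; rewrite ltcR.
  apply: le_lt_trans HN; rewrite mulrDr mulr1 mulrC.
  apply: le_trans (_ : `|opnorm (Ak k - A)| * (n ^ 2)%:R <= _).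
    by rewrite ler_wpM2r// ler_norm.
  by rewrite lerDl.
apply/seteqP; split=> l.
  rewrite {1}corr_num_rangeE => -[E E1 <-].
  exists (fun k => ntrace (Ak k *m (E *m E^t*))); split=> [k|].
    by rewrite corr_num_rangeE; exists E.
  apply/(@cvgrPdist_lt _ C^o) => e e_gt0.
  (* Radii in [C^o] are complex numbers; a positive one is real. *)
  have eE : (complex.Re e)%:C%C = e by apply/RRe_real/ger0_real/ltW.
  have [|N HN] := close (complex.Re e); first by rewrite -ltcR eE.
  by exists N => // k /= Nk; rewrite distrC -eE; exact: HN.
move=> [lam [lamA /(@cvgrPdist_lt _ C^o) lam_l]].
apply: corr_num_range_closed => e e_gt0.
have e2 : 0 < e / 2 by rewrite divr_gt0.
have [N1 HN1] := close _ e2.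
have [|N2 _ HN2] := lam_l (e / 2)%:C%C; first by rewrite ltcR.
pose k := maxn N1 N2.
have := lamA k; rewrite corr_num_rangeE => -[E E1 lamE].
exists (ntrace (A *m (E *m E^t*))).
  by rewrite corr_num_rangeE; exists E.
have := HN1 k (leq_maxl _ _) E E1; have := HN2 k (leq_maxr _ _).
rewrite /= -lamE => lt1 lt2.
rewrite -(subrKA (ntrace (Ak k *m (E *m E^t*)))).
apply: le_lt_trans (ler_normD _ _) _.
have -> : e%:C%C = (e / 2)%:C%C + (e / 2)%:C%C.
  by rewrite -rmorphD/=; congr (_%:C%C); field.
by apply: ltrD; rewrite distrC.
Qed.

End Limits.

Local Open Scope complex_scope.

Theorem theorem1 (R : realType) (n : nat) (n_ge1 : (1 <= n)%N)
    (A : 'M[R[i]]_n) :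
  (corr_num_range A =
     [set ntrace (A *m B) | B in
        [set B : 'M[R[i]]_n | psdmx B /\ forall i, B i i = 1]]) /\
  (corr_num_range A `<=` num_range A) /\
  convex_set (corr_num_range A : set (convex_lmodType (Rcomplex R))) /\
  corr_num_range A (ntrace A) /\
  (forall D : 'M[R[i]]_n, is_diag_mx D ->
     corr_num_range (A + D) = [set z + ntrace D | z in corr_num_range A]) /\
  (forall lambda : R[i],
     corr_num_range A = [set lambda] <-> is_diag_mx A /\ ntrace A = lambda) /\
  (corr_num_range A `<=` [set z : R[i] | z \is Num.real] <->
     is_diag_mx (Im_mx A) /\ ntrace (Im_mx A) = 0) /\
  (forall Ak : nat -> 'M[R[i]]_n,
     opnorm (Ak k - A) @[k --> \oo] --> (0 : R) ->
     corr_num_range A =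
       [set l : R[i] | exists lambda : nat -> R[i],
          (forall k, corr_num_range (Ak k) (lambda k)) /\
          lambda k @[k --> \oo] --> (l : R[i]^o)]) /\
  corr_num_range A^T = corr_num_range A.
Proof.
split; first exact: corr_num_range_psd.
split; first exact: corr_num_range_sub.
split; first exact: corr_num_range_convex.
split; first exact: ntrace_corr_num_range.
split; first by move=> D; exact: corr_num_range_add_diag.
split; first exact: corr_num_range_singleton.
split; first exact: corr_num_range_real.
split; first exact: corr_num_range_limit.
exact: corr_num_range_tr.
Qed.
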